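(* Let $(T,X)$ be an invertible semiflow and $(T,Y)$ a distal semiflow, with $X$ and $Y$ compact Hausdorff spaces. If $(T,X)$ is a relatively equicontinuous extension of $(T,Y)$, then $(T,X)$ is distal.
   Context: $X,Y$ are nonempty compact Hausdorff spaces, $\mathscr U_X$ is the compatible uniformity of $X$ (symmetric entourages), and $T$ is a discrete infinite semigroup with identity $e$. A semiflow $(T,X)$ is a continuous map $T\times X\to X$, $(t,x)\mapsto tx$, with $ex=x$ and $t(sx)=(ts)x$. It is invertible if for every $t\in T$ the map $x\mapsto tx$ is a bijection of $X$. It is distal if for all $x\ne y$ in $X$ there is $\alpha\in\mathscr U_X$ with $(tx,ty)\notin\alpha$ for all $t\in T$. An epimorphism $\varphi:(T,X)\to(T,Y)$ is a continuous surjection $\varphi:X\to Y$ with $\varphi(tx)=t\varphi(x)$ for all $t\in T$, $x\in X$. $(T,X)$ is a relatively equicontinuous extension of $(T,Y)$ if there is an epimorphism $\varphi:(T,X)\to(T,Y)$ such that for every $\varepsilon\in\mathscr U_X$ there is $\delta\in\mathscr U_X$ such that $(x,x')\in\delta$ and $\varphi(x)=\varphi(x')$ imply $(tx,tx')\in\varepsilon$ for all $t\in T$. *)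

(* Defs.v *)
From HB Require Import structures.
From mathcomp Require Export all_boot all_classical topology.

Set Implicit Arguments.
Unset Strict Implicit.
Unset Printing Implicit Defensive.

Local Open Scope classical_set_scope.

(* A compact Hausdorff space has exactly one compatible uniformity, so it is
   given as a [uniformType] whose induced topology is compact Hausdorff. *)
Definition nonempty_compact_hausdorff (X : uniformType) : Prop :=
  [/\ [set: X] !=set0, compact [set: X] & hausdorff_space X].

Definition sym_entourage (X : uniformType) (E : set (X * X)) : Prop :=
  entourage E /\ (E^-1)%relation = E.

(* A [monoidType] carries no topology; [discrete_topology T] is the same type
   equipped with the discrete one, and the product topology is the library's. *)
Record semiflow (T : monoidType) (X : topologicalType) := Semiflow {
  act :> T -> X -> X;
  act_continuous :
    continuous (fun p : discrete_topology T * X => act p.1 p.2);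
  act1 : forall x, act 1%g x = x;
  actM : forall t s x, act t (act s x) = act (t * s)%g x
}.

Definition invertible (T : monoidType) (X : topologicalType)
    (F : semiflow T X) : Prop :=
  forall t : T, bijective (F t).

Definition distal (T : monoidType) (X : uniformType)
    (F : semiflow T X) : Prop :=
  forall x y : X, x <> y ->
    exists alpha : set (X * X), sym_entourage alpha /\
      forall t : T, ~ alpha (F t x, F t y).

Definition epimorphism (T : monoidType) (X Y : topologicalType)
    (F : semiflow T X) (G : semiflow T Y) (phi : X -> Y) : Prop :=
  [/\ continuous phi,
      (forall y : Y, exists x : X, phi x = y) &
      forall (t : T) (x : X), phi (F t x) = G t (phi x)].

Definition rel_equicontinuous_extension (T : monoidType) (X Y : uniformType)
    (F : semiflow T X) (G : semiflow T Y) : Prop :=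
  exists phi : X -> Y, epimorphism F G phi /\
    forall eps : set (X * X), sym_entourage eps ->
      exists delta : set (X * X), sym_entourage delta /\
        forall x x' : X, delta (x, x') -> phi x = phi x' ->
          forall t : T, eps (F t x, F t x').

(* Main.v *)
(** Since the translations of [X] act by bijections, relative equicontinuity and
    the distality of [Y] (whose Ellis semigroup is a group, hence contains the
    inverse translations) keep two distinct points of [X] uniformly apart under
    all the inverse translations.  So the pointwise closure [E] of the inverse
    translations consists of injective maps.  An injective idempotent is the
    identity, so by Ellis-Numakura the compact semigroup [E] is a group.  It
    therefore contains the translations themselves, and a compact set of
    injective maps keeps distinct points uniformly apart. *)
Require Import Defs.

Set Implicit Arguments.
Unset Strict Implicit.
Unset Printing Implicit Defensive.

Local Open Scope classical_set_scope.

(** * Translations in the topology of pointwise convergence *)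

Lemma ptws_continuous (Z X Y : topologicalType) (f : Z -> {ptws X -> Y}) :
  (forall x, continuous (fun z => f z x)) -> continuous f.
Proof.
move=> fcont z; apply/cvg_sup => x U.
rewrite /= (@nbhsE (initial_topology (fun g : X -> Y => g x))).
case=> B [[C oC <-] Cfzx] /filterS; apply.
by apply: fcont; exact: open_nbhs_nbhs.
Qed.

Lemma ptws_eval_continuous (X Y : topologicalType) (x : X) :
  continuous (fun p : {ptws X -> Y} => p x).
Proof. exact: (@proj_continuous X (fun _ : X => Y) x). Qed.

Definition precomp (X : Type) (q : X -> X) (p : {ptws X -> X}) :
  {ptws X -> X} := p \o q.

(** Evaluating [p \o q] at [x] is evaluating [p] at [q x], so right translations are continuous
    whatever [q] is; left translations, below, rely on the continuity of [a]. *)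
Lemma precomp_continuous (X : topologicalType) (q : X -> X) :
  continuous (precomp q).
Proof. by apply: ptws_continuous => x; exact: ptws_eval_continuous. Qed.

Lemma ptws_postcomp_continuous (X : topologicalType) (a : X -> X) :
  continuous a ->
  continuous (fun p : {ptws X -> X} => a \o p : {ptws X -> X}).
Proof.
move=> acont; apply: ptws_continuous => x p.
apply: (@continuous_comp _ _ _ (fun r : {ptws X -> X} => r x) a).
  exact: ptws_eval_continuous.
exact: acont.
Qed.

Definition comp_closed (X : Type) (S : set (X -> X)) : Prop :=
  forall p q, S p -> S q -> S (p \o q).

Definition distal_maps (X : uniformType) (A : set (X -> X)) : Prop :=
  forall x y, x <> y -> exists alpha : set (X * X), entourage alpha /\
    forall a, A a -> ~ alpha (a x, a y).

(** For the translations of a semiflow this is the Ellis semigroup. *)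
Notation envelope A := (closure (A : set {ptws _ -> _})).

Lemma id_continuous (X : topologicalType) : continuous (@id X).
Proof. by move=> x; exact: cvg_id. Qed.

(** * Compact right topological semigroups of self-maps *)

Section CompactSpace.
Context {X : topologicalType}.
Context (cX : compact [set: X]) (hX : hausdorff_space X).

Lemma ptws_closed_compact (S : set {ptws X -> X}) : closed S -> compact S.
Proof.
move=> clS; apply: (@subclosed_compact _ _ setT clS) => //.
have /= := @tychonoff X (fun _ : X => X) (fun _ => setT) (fun _ => cX).
by congr compact; apply/seteqP; split.
Qed.

Lemma closed_precomp (S : set {ptws X -> X}) (p : X -> X) :
  closed S -> closed (precomp p @` S).
Proof.
move=> clS; apply: compact_closed; first exact: hausdorff_product.
apply: continuous_compact; last exact: ptws_closed_compact.
by apply: continuous_subspaceT; exact: precomp_continuous.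
Qed.

Lemma comp_closed_precomp (S : set {ptws X -> X}) (p : X -> X) :
  comp_closed S -> S p -> comp_closed (precomp p @` S).
Proof.
move=> SM Sp _ _ [q Sq <-] [r Sr <-]; exists (q \o (p \o r)) => //.
exact: SM _ _ Sq (SM _ _ Sp Sr).
Qed.

(** For p in a minimal closed subsemigroup M, minimality gives M p = M. The q in M with q p = p then
    form a nonempty closed subsemigroup, hence all of M, so p p = p. *)
Lemma ellis_numakura (S : set {ptws X -> X}) :
  closed S -> S !=set0 -> comp_closed S -> exists2 u, S u & u \o u = u.
Proof.
move=> clS S0 SM.
(* [Zorn_bigcup] yields maximal sets, so a minimal closed subsemigroup is
   obtained as the complement of a maximal [U]. *)
pose P (U : set {ptws X -> X}) :=
  [/\ closed (S `\` U), S `\` U !=set0 & comp_closed (S `\` U)].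
have [U [[clM [p Mp] MM] Umax]] : exists U, P U /\ forall V, U `<` V -> ~ P V.
  apply: Zorn_bigcup => F FP Ftot.
  have [->|/set0P [U0 FU0]] := eqVneq F set0.
    by rewrite bigcup_set0 /P setD0.
  have DF : S `\` \bigcup_(V in F) V = \bigcap_(V in F) (S `\` V).
    apply/seteqP; split=> [q [Sq nq] V FV|q Fq].
      by split=> // Vq; apply: nq; exists V.
    split; first by have [] := Fq _ FU0.
    by case=> V FV Vq; have [] := Fq _ FV.
  rewrite /P DF; split.
  - by apply: closed_bigI => V /FP [].
  (* The remainders of [S] form a chain, so they generate a proper filter; being closed, they all
     contain each of its cluster points. *)
  - pose G := filter_from F (fun V => S `\` V).
    have GF : ProperFilter G.
      apply: filter_from_proper; last by move=> V /FP [].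
      apply: filter_from_filter; first by exists U0.
      move=> V W FV FW; have [VW|WV] := Ftot _ _ FV FW.
        by exists W => // q [Sq nWq]; split; split=> // /VW.
      by exists V => // q [Sq nVq]; split; split=> // /WV.
    have [|q [_ Gq]] := ptws_closed_compact clS (F := G).
      by exists U0 => // q [].
    exists q => V FV; have [clV _ _] := FP _ FV.
    by apply: clV => B /Gq; apply; exists V.
  - move=> q r Fq Fr V FV; have [_ _ VM] := FP _ FV.
    by apply: VM; [exact: Fq|exact: Fr].
have minM (N : set {ptws X -> X}) : closed N -> N !=set0 -> comp_closed N ->
    N `<=` S `\` U -> S `\` U `<=` N.
  move=> clN N0 NM NU; have SDN : S `\` (~` N) = N.
    by rewrite setDE setCK; apply/setIidPr => q /NU [].
  have UN : U `<=` ~` N by move=> q Uq /NU [].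
  apply: contrapT => MN; apply: (Umax (~` N)); last by rewrite /P SDN.
  split=> // NU'; apply: MN => q [_ nUq]; apply: contrapT => nNq.
  exact/nUq/NU'.
exists p; first by case: Mp.
have MpS : S `\` U `<=` precomp p @` (S `\` U).
  apply: minM.
  - exact: closed_precomp.
  - by exists (p \o p); exists p.
  - exact: comp_closed_precomp.
  - by move=> _ [q Mq <-]; exact: MM.
pose N : set {ptws X -> X} := (S `\` U) `&` precomp p @^-1` [set p].
suff MN : S `\` U `<=` N by have [] := MN _ Mp.
apply: minM; last by move=> q [].
- apply: closedI => //.
  apply: preimage_closed; first by move=> q _; exact: precomp_continuous.
  apply: accessible_closed_set1; apply: hausdorff_accessible.
  exact: hausdorff_product.
- by have [q Mq qp] := MpS _ Mp; exists q.
- move=> q r [Mq qp] [Mr rp]; split; first exact: MM.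
  change (precomp (precomp p r) q = p).
  by rewrite [precomp p r]rp.
Qed.

(** Ellis-Numakura in the closed subsemigroup S p yields an idempotent q p. Being injective, it is
    the identity, and injectivity of q makes this left inverse two-sided. *)
Lemma comp_closed_inverse (S : set {ptws X -> X}) :
  closed S -> comp_closed S -> (forall p, S p -> injective p) ->
  forall p, S p -> exists2 q, S q & cancel p q /\ cancel q p.
Proof.
move=> clS SM Sinj p Sp.
have [||_ [q Sq <-] qpid] := ellis_numakura (closed_precomp (p := p) clS).
- by exists (p \o p); exists p.
- exact: comp_closed_precomp.
have pq : cancel p q.
  by move=> x; apply: (Sinj _ (SM _ _ Sq Sp)); exact: (congr1 (@^~ x) qpid).
by exists q => //; split=> // x; apply: (Sinj _ Sq); rewrite pq.
Qed.

End CompactSpace.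

(** * Envelopes and uniform separation of points *)

Lemma envelope_comp_closed (X : topologicalType) (A : set (X -> X)) :
  (forall a, A a -> continuous a) -> comp_closed A -> comp_closed (envelope A).
Proof.
move=> Acont AM.
(* Two passages to the limit: first in the right factor, with a continuous left factor from [A],
   then in the left factor, through [precomp q]. *)
have closure_sub (f : {ptws X -> X} -> {ptws X -> X}) : continuous f ->
    A `<=` f @^-1` envelope A -> envelope A `<=` f @^-1` envelope A.
  move=> fcont Af; rewrite [X in X `<=` _]closureE; apply: smallest_sub => //.
  by apply: preimage_closed => [? _|]; [exact: fcont|exact: closed_closure].
have aE a q : A a -> envelope A q -> envelope A (a \o q).
  move=> Aa; apply: closure_sub; first exact/ptws_postcomp_continuous/Acont.
  by move=> b Ab; apply: subset_closure; exact: AM.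
move=> p q Ep Eq.
apply: (closure_sub (precomp q)) Ep.
  exact: precomp_continuous.
by move=> a Aa; exact: aE.
Qed.

(** Otherwise some [a] in [A] near [p] brings [f (a x)] and [f (a y)] both close to the common
    value, hence into [alpha]. The map [f] will be the identity for points in one fibre of [phi],
    and [phi] itself for points in different fibres. *)
Lemma envelope_separated (X : topologicalType) (Y : uniformType) (f : X -> Y)
    (A : set (X -> X)) (alpha : set (Y * Y)) (x y : X) (p : {ptws X -> X}) :
  continuous f -> entourage alpha ->
  (forall a, A a -> ~ alpha (f (a x), f (a y))) ->
  envelope A p -> f (p x) <> f (p y).
Proof.
move=> fcont ea Aa Ap fpxy.
pose beta := split_ent alpha `&` (split_ent alpha)^-1%relation.
have eb : entourage beta by exact: entourage_invI.
have nb z : nbhs p [set q | beta (f (p z), f (q z))].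
  have : (fun q : {ptws X -> X} => f (q z)) @ nbhs p --> f (p z).
    apply: (@continuous_comp _ _ _ (fun r : {ptws X -> X} => r z) f).
      exact: ptws_eval_continuous.
    exact: fcont.
  by move=> /cvg_app_entourageP; apply.
have [|a [Aa' [/= ax ay]]] := Ap _ (filterI (nb x) (nb y)).
  exact: (@nbhs_filter (prod_topology (fun _ : X => X)) p).
rewrite fpxy in ax; case: ax ay => _ ax [ay _].
by apply: (Aa a) => //; apply: entourage_split ax ay.
Qed.

Lemma distal_maps_injective (X : uniformType) (A : set (X -> X)) :
  distal_maps A -> forall p, envelope A p -> injective p.
Proof.
move=> Adist p Ap x y pxy; apply: contrapT => /Adist [alpha [ea Aa]].
exact: (envelope_separated (@id_continuous X) ea Aa Ap pxy).
Qed.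

(** Near each [p] in [K] one entourage already separates the images of [x] and [y]; compactness, as
    a near-covering along the filter of small entourages, makes it uniform. *)
Lemma compact_injective_distal (X : uniformType) (K : set {ptws X -> X}) :
  hausdorff_space X -> compact K -> (forall p, K p -> injective p) ->
  distal_maps K.
Proof.
move=> hX cK Kinj x y xy.
pose P (E : set (X * X)) (p : {ptws X -> X}) := ~ E (p x, p y).
have entF : ProperFilter (@entourage X).
  apply: Build_ProperFilter_ex => E entE.
  by exists (x, x); exact: entourage_refl.
pose S := powerset_filter_from (@entourage X).
have Pnear p : K p -> \forall q \near p & E \near S, P E q.
  move=> Kp.
  have : p x != p y by apply/eqP => /(Kinj _ Kp).
  move: hX; rewrite open_hausdorff => /[apply].
  case=> -[B C] /= [/set_mem Bp /set_mem Cp] [oB oC BC0].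
  have [E entE EB] : exists2 E, entourage E & xsection E (p x) `<=` B.
    have /nbhsP [E entE EB] : nbhs (p x) B by exact: open_nbhs_nbhs.
    by exists E.
  (* With [q x] this close to [p x], a pair [(q x, q y)] in [D] would put [q y] in [B], which is
     disjoint from [C]. *)
  exists ([set q | split_ent E (p x, q x) /\ C (q y)],
          [set D | D `<=` split_ent E]) => /=.
    split.
      apply: filterI.
      - exact: (@nbhs_filter (prod_topology (fun _ : X => X)) p).
      - have : (fun q : {ptws X -> X} => q x) @ nbhs p --> p x.
          exact: ptws_eval_continuous.
        by move=> /cvg_app_entourageP; apply.
      - apply: (@ptws_eval_continuous X X y p C).
        exact: open_nbhs_nbhs.
    exact: small_set_sub.
  move=> [q D] /= [[Eq Cq] DE] /DE Eqq.
  have /EB Bq : xsection E (p x) (q y).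
    by rewrite /xsection /= inE; apply: entourage_split Eq Eqq.
  by move/eqP/seteqP: BC0 => [/(_ (q y)) + _]; apply.
have := (compact_near_coveringP K).1 cK _ S P _ Pnear.
move=> /(_ (@powerset_filter_from_filter _ _ entF)).
rewrite near_powerset_filter_fromP => [[E entE KE]|].
  by exists E.
by move=> E D ED Dn p Kp /ED; exact: Dn.
Qed.

(** Ellis's theorem: distality makes the enveloping semigroup a group. *)
Lemma distal_maps_inverse (X : uniformType) (A : set (X -> X)) :
  compact [set: X] -> hausdorff_space X ->
  (forall a, A a -> continuous a) -> comp_closed A -> distal_maps A ->
  forall p, envelope A p -> exists2 q, envelope A q & cancel p q /\ cancel q p.
Proof.
move=> cX hX Acont AM Adist.
apply: comp_closed_inverse => //; first exact: closed_closure.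
  exact: envelope_comp_closed.
exact: distal_maps_injective.
Qed.

Lemma inverse_continuous (X Y : topologicalType) (f : X -> Y) (g : Y -> X) :
  compact [set: X] -> hausdorff_space Y -> continuous f ->
  cancel f g -> cancel g f -> continuous g.
Proof.
move=> cX hY fcont fg gf; apply/continuous_closedP => C clC.
have -> : g @^-1` C = f @` C.
  apply/seteqP; split=> [y Cgy|_ [x Cx <-]]; last by rewrite /= fg.
  by exists (g y).
apply: compact_closed => //; apply: continuous_compact.
  exact: continuous_subspaceT.
exact: subclosed_compact clC cX _.
Qed.

Lemma hausdorff_sym_entourage (X : uniformType) (x y : X) :
  hausdorff_space X -> x <> y ->
  exists2 E : set (X * X), sym_entourage E & ~ E (x, y).
Proof.
move=> hX xy; apply: contrapT => nE; apply/xy/hX => U V xU yV.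
have /nbhsP [E entE EU] := xU.
exists y; split; last exact: nbhs_singleton.
apply: EU; rewrite /xsection /= inE; apply: contrapT => nExy; apply: nE.
exists (E `&` E^-1%relation); last by case.
split; first exact: entourage_invI.
by apply/seteqP; split=> -[u v] [].
Qed.

(** * Translations of semiflows and their inverses *)

Section Semiflow.
Context {T : monoidType}.

Lemma act_continuousr (X : topologicalType) (F : semiflow T X) (t : T) :
  continuous (F t).
Proof.
move=> x; apply: (@continuous_comp _ _ _
  (fun z : X => (t, z) : discrete_topology T * X) (fun p => F p.1 p.2)).
  apply: (@cvg_pair _ _ _ _ (nbhs (t : discrete_topology T)) _ _ _ _
    (cst t) id).
    exact: cvg_cst.
  exact: cvg_id.
exact: act_continuous.
Qed.

Definition translations (X : topologicalType) (F : semiflow T X) :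
  set (X -> X) := [set a | exists t, a = F t].

Definition inverse_translations (X : topologicalType) (F : semiflow T X) :
  set (X -> X) := [set a | exists t, cancel (F t) a /\ cancel a (F t)].

Lemma translations_comp_closed (X : topologicalType) (F : semiflow T X) :
  comp_closed (translations F).
Proof.
move=> _ _ [s ->] [t ->]; exists (s * t)%g.
by apply/funext => x /=; rewrite actM.
Qed.

Lemma inverse_translations_comp_closed (X : topologicalType)
    (F : semiflow T X) : comp_closed (inverse_translations F).
Proof.
move=> a b [s [sa as_]] [t [tb bt]]; exists (t * s)%g.
by split=> x /=; rewrite -actM ?tb ?sa ?as_ ?bt.
Qed.

Lemma distalP (X : uniformType) (F : semiflow T X) :
  distal F <-> distal_maps (translations F).
Proof.
split=> dF x y /dF [alpha].
  by case=> -[ea _] Fa; exists alpha; split=> // _ [t ->].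
case=> ea Fa; exists (alpha `&` alpha^-1%relation); split.
  split; first exact: entourage_invI.
  by apply/seteqP; split=> -[u v] [].
by move=> t [+ _]; apply: Fa; exists t.
Qed.

(** The inverse [q] of [F t] lies in the Ellis semigroup, a compact set of injective maps, and
    [u = q x], [v = q y]. *)
Lemma distal_backward (X : uniformType) (F : semiflow T X) (x y : X) :
  compact [set: X] -> hausdorff_space X -> distal F -> x <> y ->
  exists alpha : set (X * X), entourage alpha /\
    forall t u v, F t u = x -> F t v = y -> ~ alpha (u, v).
Proof.
move=> cX hX /distalP dF xy.
have Fcont a : translations F a -> continuous a.
  by move=> [t ->]; exact: act_continuousr.
have [alpha [ea Ea]] := compact_injective_distal hX
  (ptws_closed_compact cX (@closed_closure _ _)) (distal_maps_injective dF) xy.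
exists alpha; split=> // t u v Fu Fv.
have Et : envelope (translations F) (F t) by apply: subset_closure; exists t.
have [q Eq [tq _]] := distal_maps_inverse cX hX Fcont
  (@translations_comp_closed _ F) dF Et.
by rewrite -[u]tq -[v]tq Fu Fv; exact: Ea.
Qed.

End Semiflow.

Theorem theorem1p21 (T : monoidType) (X Y : uniformType)
    (F : semiflow T X) (G : semiflow T Y)
    (infT : infinite_set [set: T])
    (chX : nonempty_compact_hausdorff X)
    (chY : nonempty_compact_hausdorff Y)
    (invF : invertible F)
    (distG : distal G)
    (extFG : rel_equicontinuous_extension F G) :
  distal F.
Proof.
have [_ cX hX] := chX; have [_ cY hY] := chY.
have [phi [[phic phis phiF] equi]] := extFG.
pose A := inverse_translations F.
have Acont a : A a -> continuous a.
  move=> [t [ta at_]]; apply: inverse_continuous ta at_ => //.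
  exact: act_continuousr.
have Ginj t : injective (G t).
  move=> u v Guv; apply: contrapT => /distG [alpha [[ea _] /(_ t)]].
  by rewrite Guv; apply; exact: entourage_refl.
have Ainj p : envelope A p -> injective p.
  move=> Ap x y; apply: contraPP => xy.
  have [phixy|phixy] := pselect (phi x = phi y).
    (* Same fibre: [a x] and [a y] also share a fibre, by [Ginj]. Were they [delta]-close, applying
       [F t] would put [(x, y)] in [eps]. *)
    have [eps epsS nexy] := hausdorff_sym_entourage hX xy.
    have [delta [[ed _] dE]] := equi _ epsS.
    apply: (envelope_separated (@id_continuous X) ed _ Ap).
    move=> a [t [_ at_]] /dE H.
    apply: nexy; rewrite -[x]at_ -[y]at_; apply: H.
    by apply: (Ginj t); rewrite -!phiF !at_.
  (* Different fibres: [G t] sends [phi (a x)] and [phi (a y)] to [phi x] and [phi y], so distality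
     of [G] backward in time separates them. *)
  have [alpha [ea nalpha]] := distal_backward cY hY distG phixy.
  have : phi (p x) <> phi (p y).
    apply: (envelope_separated phic ea _ Ap) => a [t [_ at_]].
    by apply: (nalpha t); rewrite -phiF at_.
  by apply: contra_not => ->.
have clA : closed (envelope A) := @closed_closure _ _.
have AM : comp_closed (envelope A).
  apply: envelope_comp_closed => //; exact: inverse_translations_comp_closed.
apply/distalP => x y xy.
have [alpha [ea Ea]] := compact_injective_distal hX
  (ptws_closed_compact cX clA) Ainj xy.
exists alpha; split=> // _ [t ->]; apply: Ea.
(* [F t] is the inverse of [a], hence equals the inverse [q] of [a] found in the envelope. *)
have [a ta at_] := invF t.
have Aa : envelope A a by apply: subset_closure; exists t.
have [q Aq [aq _]] := comp_closed_inverse cX hX clA AM Ainj Aa.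
suff -> : F t = q by [].
by apply/funext => z; rewrite -[z in RHS]ta aq.
Qed.
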